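(* For all sufficiently large $n$, every $G\in W(n)$ maximizing $P(G)$ over $W(n)$ also maximizes $P$ over $F(n,4,15)$. Consequently $$ {\rm ex}_{\Pi}(n,4,15)=\max_{G\in W(n)}P(G)=2^{\gamma n^2+O(n)}\quad\text{and}\quad {\rm ex}_{\Pi}(4,15)=2^{2\gamma}, $$ where $\beta=\frac{\log 3}{2\log 3-\log 2}$ and $\gamma=\beta^2/2+\beta(1-\beta)\log_2 3$.
   Context: A multigraph is a pair $(V,w)$ with $w:\binom{V}{2}\to\mathbb{N}$. A multigraph is a $(4,15)$-graph if every 4-element vertex set $X$ satisfies $\sum_{xy\in\binom{X}{2}}w(xy)\le 15$; $F(n,4,15)$ is the set of $(4,15)$-graphs on vertex set $[n]$. $P(G)=\prod_{xy}w(xy)$, ${\rm ex}_{\Pi}(n,4,15)=\max\{P(G):G\in F(n,4,15)\}$, ${\rm ex}_{\Pi}(4,15)=\lim_{n\to\infty}{\rm ex}_{\Pi}(n,4,15)^{1/\binom n2}$. $W(n)$ is the set of multigraphs $([n],w)$ for which there is a partition $L,R$ of $[n]$ with $w(xy)=1$ for $xy\in\binom{L}{2}$, $w(xy)=2$ for $xy\in\binom{R}{2}$, and $w(xy)=3$ for $x\in L,y\in R$. Logarithms are natural unless a base is given. *)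

(* Defs.v *)
From mathcomp Require Import all_boot all_order all_algebra.
From mathcomp Require Import all_classical all_reals all_analysis.

Set Implicit Arguments.
Unset Strict Implicit.
Unset Printing Implicit Defensive.

Import Order.TTheory GRing.Theory Num.Theory.
Import numFieldNormedType.Exports.

Local Open Scope classical_set_scope.
Local Open Scope ring_scope.

Notation pairs V := {e : {set V} | #|e| == 2%N}.

Definition multigraph (V : finType) : Type := {ffun pairs V -> nat}.

Definition weight_in (V : finType) (G : multigraph V) (X : {set V}) : nat :=
  (\sum_(e : pairs V | sval e \subset X) G e)%N.

Definition Pprod (V : finType) (G : multigraph V) : nat :=
  (\prod_(e : pairs V) G e)%N.

Definition is_sq_graph (s q : nat) (V : finType) (G : multigraph V) : Prop :=
  forall X : {set V}, #|X| = s -> (weight_in G X <= q)%N.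

Definition Fset (n s q : nat) : set (multigraph 'I_n) :=
  [set G : multigraph 'I_n | is_sq_graph s q G].

Arguments Fset : clear implicits.

(* The parts L and R may be empty. *)
Definition Wset (n : nat) : set (multigraph 'I_n) :=
  [set G : multigraph 'I_n | exists L R : {set 'I_n},
     [/\ L :|: R = [set: 'I_n]%SET, [disjoint L & R]%B &
      forall (e : pairs 'I_n) (x y : 'I_n), sval e = [set x; y]%SET ->
        [/\ x \in L -> y \in L -> G e = 1%N,
            x \in R -> y \in R -> G e = 2%N &
            x \in L -> y \in R -> G e = 3%N]]].

Arguments Wset : clear implicits.

Definition maximizes (V : finType) (A : set (multigraph V))
  (G : multigraph V) : Prop :=
  A G /\ forall H, A H -> (Pprod H <= Pprod G)%N.

(* The greatest element of [set P(G) | G in A]; it is 0 by convention if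
   there is none, as for A = Fset n s q with 2 <= n < s, which is unbounded. *)
Definition maxP (V : finType) (A : set (multigraph V)) : nat :=
  xget 0%N [set m | exists2 G, maximizes A G & m = Pprod G].

Definition ex_Pi (n s q : nat) : nat := maxP (Fset n s q).

Definition ex_Pi_root (R : realType) (s q : nat) : R^nat :=
  fun n => (ex_Pi n s q)%:R `^ ('C(n, 2)%:R)^-1.

Definition ex_Pi_lim (R : realType) (s q : nat) : R :=
  lim (ex_Pi_root R s q @ \oo).

Definition log (R : realType) (b x : R) : R := ln x / ln b.

Definition beta (R : realType) : R := ln 3 / (2 * ln 3 - ln 2).

Definition gamma (R : realType) : R :=
  beta R ^+ 2 / 2 + beta R * (1 - beta R) * log 2 3.

(* Main.v *)
Require Import Defs.
From mathcomp Require Import all_boot all_order all_algebra.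
From mathcomp Require Import all_classical all_reals all_analysis.
From mathcomp Require Import zify ring lra.
Import Order.TTheory GRing.Theory Num.Theory.
Import numFieldNormedType.Exports.

(** Write P^2 as the product of a symmetric weight w over ordered pairs, with
    w x x = 1, and let rho(n) be the ratio of the (4,15)-maximum to the maximum
    over W(n). Suppose a set S of k <= 5 vertices is light: the product of w s u
    over s in S is, for every u outside S, below 3^(8k/11), a lower bound for the
    growth factor of the W-maximum. Then deleting S gives rho(n) <= rho(n-k)/2
    for large n, so iterating, light sets can be assumed absent for large n.
    Without them every triple weighs at most 8 and every edge at most 3. Zykov
    symmetrization then makes weight 1 occur only between clones; up to clones
    the weight-3 graph has no triangle, no pentagon, no path with three edges
    and no two separate edges, and it meets every vertex. Hence it is a star,
    and w is dominated by a member of W(n). *)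

(** * The maximum of P over W(n) and its growth with n *)

Section Star.
Set Implicit Arguments.
Unset Strict Implicit.
Local Open Scope nat_scope.

(** The value of P at a member of W(a + b) with |L| = a and |R| = b. *)
Definition star_prod a b := 3 ^ (a * b) * 2 ^ 'C(b, 2).

Definition star_max n := \max_(a < n.+1) star_prod a (n - a).

Lemma leq_expn2r m n e : m <= n -> m ^ e <= n ^ e.
Proof. by case: e => // e; rewrite leq_exp2r. Qed.

Lemma star_prod_gt0 a b : 0 < star_prod a b.
Proof. by rewrite muln_gt0 !expn_gt0. Qed.

Lemma star_prod_le_max a b : star_prod a b <= star_max (a + b).
Proof.
have lt_a : a < (a + b).+1 by lia.
have := @bigop.leq_bigmax _ (fun i : 'I_(a + b).+1 => star_prod i (a + b - i)) (Ordinal lt_a).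
by rewrite /= addKn.
Qed.

Lemma star_max_attained n : exists a b, a + b = n /\ star_max n = star_prod a b.
Proof.
have [|a ea] := @bigop.eq_bigmax _ (fun a : 'I_n.+1 => star_prod a (n - a)).
  by rewrite card_ord.
by exists a, (n - a); split; [have := ltn_ord a; lia|].
Qed.

Lemma star_max_gt0 n : 0 < star_max n.
Proof. by have [a [b [_ ->]]] := star_max_attained n; exact: star_prod_gt0. Qed.

Lemma star_prodSl a b : star_prod a.+1 b = star_prod a b * 3 ^ b.
Proof. by rewrite /star_prod mulSn expnD -mulnA mulnC. Qed.

Lemma star_prodSr a b : star_prod a b.+1 = star_prod a b * (3 ^ a * 2 ^ b).
Proof. by rewrite /star_prod mulnS binS bin1 !expnD; nia. Qed.

(* The ratio 8/11 is slightly below the optimal share of [b] in [a + b]. *)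
Lemma star_exp_ineq a b :
  11 * b < 8 * (a + b) -> 3 ^ (8 * (a + b)) <= 3 ^ (11 * a) * 2 ^ (11 * b).
Proof.
move=> lt_b; pose c := 8 * (a + b) - 11 * b.
have -> : 11 * a = 3 * (a + b) + c by rewrite /c; lia.
have e2 : 2 ^ (8 * (a + b)) = 2 ^ (11 * b) * 2 ^ c.
  by rewrite -expnD; congr (_ ^ _); rewrite /c; lia.
(* The numerical core is 3^5 <= 2^8; the surplus exponent [c] then needs only 2 <= 3. *)
apply: (@leq_trans (3 ^ (3 * (a + b)) * 2 ^ (8 * (a + b)))).
  rewrite (expnM 3 8) (expnM 3 3) (expnM 2 8) -(expnMn (3 ^ 3)).
  by apply: leq_expn2r; lia.
rewrite e2 expnD -!mulnA leq_pmul2l ?expn_gt0 // mulnC leq_pmul2r ?expn_gt0 //.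
exact: leq_expn2r.
Qed.

(** Enlarge an optimal pair (a, b): the new vertex joins L, with factor 3^b, when b is at least 8/11
    of a + b, and R, with factor 3^a 2^b, otherwise. Eleventh powers keep the exponents integral. *)
Lemma star_maxS m : star_max m ^ 11 * 3 ^ (8 * m) <= star_max m.+1 ^ 11.
Proof.
have [a [b [<- ->]]] := star_max_attained m.
have [le_b|lt_b] := leqP (8 * (a + b)) (11 * b).
  apply: (@leq_trans (star_prod a.+1 b ^ 11)).
    by rewrite star_prodSl expnMn -expnM leq_pmul2l ?expn_gt0 ?star_prod_gt0 //
      leq_pexp2l //; lia.
  by apply: leq_expn2r; rewrite -addSn star_prod_le_max.
apply: (@leq_trans (star_prod a b.+1 ^ 11)).
  rewrite star_prodSr expnMn leq_pmul2l ?expn_gt0 ?star_prod_gt0 //.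
  by rewrite expnMn -!expnM ![_ * 11]mulnC star_exp_ineq.
by apply: leq_expn2r; rewrite -addnS star_prod_le_max.
Qed.

Lemma star_max_add m k :
  star_max m ^ 11 * (3 ^ (8 * k)) ^ m <= star_max (m + k) ^ 11.
Proof.
elim: k => [|k IHk]; first by rewrite exp1n muln1 addn0.
rewrite addnS; apply: leq_trans (star_maxS _).
have -> : 8 * k.+1 = 8 * k + 8 by lia.
rewrite expnD expnMn mulnA leq_mul //.
by rewrite -expnM leq_pexp2l //; lia.
Qed.

(** Bernoulli's inequality for (1 + 1/5)^m: the margin 6/5 demanded in [light_set] eventually beats
    any constant. *)
Lemma exp_ratio_unbounded C m : 5 * C <= m -> C * 5 ^ m <= 6 ^ m.
Proof.
move=> le_m; suff: (5 + m) * 5 ^ m <= 5 * 6 ^ m by nia.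
by elim: m {le_m} => [//|m IHm]; rewrite !expnS; nia.
Qed.

End Star.

(** * Deleting light sets, and iterating the deletion *)

Section Deletion.
Set Implicit Arguments.
Unset Strict Implicit.
Local Open Scope nat_scope.

Definition is_15_weight (T : finType) (w : T -> T -> nat) :=
  [/\ forall x y, w x y = w y x, forall x, w x x = 1 &
      forall x y z t, uniq [:: x; y; z; t] ->
        w x y + w x z + w x t + w y z + w y t + w z t <= 15].

Definition sqprod (T : finType) (w : T -> T -> nat) := \prod_x \prod_y w x y.

Lemma is_15_weight_le (T : finType) (w : T -> T -> nat) x y :
  4 <= #|T| -> is_15_weight w -> w x y <= 15.
Proof.
move=> T4 [wC w1 w15]; have [<-|neq_xy] := eqVneq x y; first by rewrite w1.
have : 1 < #|~: [set x; y]|.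
  by have := cardsC [set x; y]; rewrite cards2 neq_xy; move=> /= e; move: T4; rewrite -e.
move=> /card_gt1P [z [t [+ + neq_zt]]].
rewrite !inE !negb_or => /andP[zx zy] /andP[tx ty].
have := w15 x y z t; rewrite /= !inE !negb_or neq_xy neq_zt.
rewrite ![x == _]eq_sym ![y == _]eq_sym zx zy tx ty => /(_ isT).
lia.
Qed.

(** Kept general because it splits products of weights and, through [big_redirect], sums counting
    clones. *)
Lemma big_square_split (R : Type) (idx : R) (op : Monoid.com_law idx)
    (T : finType) (S : pred T) (F : T -> T -> R) :
  (forall x y, F x y = F y x) ->
  let B := \big[op/idx]_(x | x \notin S) \big[op/idx]_(y in S) F x y in
  \big[op/idx]_x \big[op/idx]_y F x y =
  op (op (\big[op/idx]_(x in S) \big[op/idx]_(y in S) F x y) (op B B))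
     (\big[op/idx]_(x | x \notin S) \big[op/idx]_(y | y \notin S) F x y).
Proof.
move=> FC B; under eq_bigr => x _ do rewrite (bigID (mem S)) /=.
rewrite big_split /= !(bigID (mem S) predT) /=.
have -> : \big[op/idx]_(x in S) \big[op/idx]_(y | y \notin S) F x y = B.
  by rewrite exchange_big; apply: eq_bigr => x _; apply: eq_bigr => y _.
by rewrite !Monoid.mulmA.
Qed.

Lemma sqprod_le (T : finType) (w : T -> T -> nat) :
  4 <= #|T| -> is_15_weight w -> sqprod w <= 15 ^ (#|T| * #|T|).
Proof.
move=> T4 hw; apply: (@leq_trans (\prod_(x : T) \prod_(y : T) 15)).
  apply: leq_prod => x _; apply: leq_prod => y _; exact: is_15_weight_le.
by rewrite !prod_nat_const -expnM.
Qed.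

(** Pairs inside [S] cost a constant, and each vertex outside [S] meets [S] in a product of at most
    [M], counted in both orders; the other pairs make up [sqprod w']. *)
Lemma delete_vertices : exists C, forall (T : finType) (w : T -> T -> nat) S M,
  4 <= #|T| -> is_15_weight w -> uniq S -> size S <= 5 ->
  (forall u, u \notin S -> \prod_(s <- S) w s u <= M) ->
  exists (T' : finType) (w' : T' -> T' -> nat),
    [/\ is_15_weight w', #|T'| = #|T| - size S &
        sqprod w <= C * M ^ (2 * #|T'|) * sqprod w'].
Proof.
(* At most 5 * 5 ordered pairs lie inside [S], each of weight at most 15. *)
exists (15 ^ 25) => T w S M T4 hw uS sS hM.
have [wC w1 w15] := hw.
pose A := [set x | x \notin S].
exists 'I_#|A|, (fun i j => w (enum_val i) (enum_val j)).
have cA : #|A| = #|T| - size S.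
  rewrite -(card_uniqP uS) -(cardC (mem S)) addKn.
  by apply: eq_card => x; rewrite !inE.
split; last 2 first.
- by rewrite card_ord.
- rewrite /sqprod (big_square_split _ (mem S)) //= mulnn card_ord.
  apply: leq_mul; last first.
    apply: eq_leq.
    transitivity (\prod_(x in A) \prod_(y in A) w x y).
      apply: eq_big => [x|x _]; first by rewrite !inE.
      by apply: eq_bigl => y; rewrite !inE.
    rewrite big_enum_val; apply: eq_bigr => i _; exact: big_enum_val.
  apply: leq_mul.
    apply: (@leq_trans (\prod_(x in S) 15 ^ size S)).
      apply: leq_prod => x _; rewrite -(card_uniqP uS) -prod_nat_const.
      by apply: leq_prod => y _; exact: is_15_weight_le.
    rewrite prod_nat_const (card_uniqP uS) -expnM leq_pexp2l //.
    by rewrite (@leq_mul _ _ 5 5).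
  rewrite mulnC expnM; apply: leq_expn2r.
  apply: (@leq_trans (\prod_(x in A) M)); last by rewrite prod_nat_const.
  rewrite (eq_bigl (mem A)) => [|x]; last by rewrite !inE.
  apply: leq_prod => x xA; have xS : x \notin S by move: xA; rewrite !inE.
  have := hM x xS; rewrite big_uniq //=.
  by under eq_bigr => s _ do rewrite wC.
- split=> [i j|i|i j k l u]; [exact: wC|exact: w1|].
  by apply: w15; rewrite -(map_inj_uniq enum_val_inj) in u.
Qed.

(* [6 * M ^ 11 <= 5 * 3 ^ (8 * k)] is [M < 3 ^ (8 * k / 11)] with a margin, see
   [star_max_add]; it is tightest at k = 4, M = 24. *)
Definition light_set (T : finType) (w : T -> T -> nat) (S : seq T) M :=
  [/\ uniq S, 0 < size S <= 5, M ^ 11 * 6 <= 5 * 3 ^ (8 * size S) &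
      forall u, u \notin S -> \prod_(s <- S) w s u <= M].

(** Each remaining vertex gains the margin 6/5 twice over the growth of [star_max]; for large [#|T|]
    this swallows the constant of [delete_vertices] and leaves a factor 2. *)
Lemma light_set_descent : exists n0, forall (T : finType) (w : T -> T -> nat) S M,
  n0 <= #|T| -> is_15_weight w -> light_set w S M ->
  exists (T' : finType) (w' : T' -> T' -> nat),
    [/\ is_15_weight w', #|T'| < #|T| <= #|T'| + 5 &
        2 * sqprod w ^ 11 * (star_max #|T'| ^ 2) ^ 11 <=
        sqprod w' ^ 11 * (star_max #|T| ^ 2) ^ 11].
Proof.
have [C hC] := delete_vertices.
exists (5 * (2 * C ^ 11) + 10) => T w S M.
set D := 2 * C ^ 11 => Tn hw [uS /andP[S0 S5] hM hu].
have T4 : 4 <= #|T| by lia.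
have [T' [w' [hw' cT' le_w]]] := hC T w S M T4 hw uS S5 hu.
have {}cT' : #|T'| = #|T| - size S := cT'.
exists T', w'; split=> //; first by lia.
set m := #|T'| in cT' le_w *.
have eT : #|T| = m + size S by lia.
have := star_max_add m (size S); rewrite -eT.
set X := star_max m; set Y := star_max #|T| => hXY.
have hD : D * (M ^ 11) ^ (2 * m) <= (3 ^ (8 * size S)) ^ (2 * m).
  rewrite -(@leq_pmul2l (5 ^ (2 * m))) ?expn_gt0 // -expnMn.
  apply: (@leq_trans ((M ^ 11 * 6) ^ (2 * m))); last first.
    exact: leq_expn2r.
  rewrite expnMn mulnA mulnC leq_mul // mulnC.
  by apply: exp_ratio_unbounded; lia.
have hXY2 : (X ^ 11) ^ 2 * (3 ^ (8 * size S)) ^ (2 * m) <= (Y ^ 11) ^ 2.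
  by rewrite [2 * m]mulnC [_ ^ (m * 2)]expnM -expnMn leq_expn2r.
have hQ : sqprod w ^ 11 <= C ^ 11 * (M ^ 11) ^ (2 * m) * sqprod w' ^ 11.
  by rewrite -expnM [11 * _]mulnC expnM -!expnMn leq_expn2r.
have swap n : (n ^ 2) ^ 11 = (n ^ 11) ^ 2 by rewrite -!expnM.
rewrite !swap; move: hD hXY2 hQ; rewrite /D.
move: ((X ^ 11) ^ 2) ((Y ^ 11) ^ 2) (_ ^ (2 * m)) (_ ^ (2 * m)) => x y r p.
move: (sqprod w ^ 11) (sqprod w' ^ 11) (C ^ 11) => q q' c hD le_xy hQ.
apply: (@leq_trans (2 * (c * p * q') * x)).
  by rewrite leq_mul2r leq_mul2l hQ !orbT.
apply: (@leq_trans (q' * (x * r))); last by rewrite leq_mul2l le_xy orbT.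
have -> : 2 * (c * p * q') * x = q' * (x * (2 * c * p)) by lia.
by rewrite !leq_mul2l hD !orbT.
Qed.

(** Strong induction on the number of vertices. Below [n1] the ratio is at most [K], and each
    descent halves it, so a large start yields enough halvings to absorb [K]. If the bound already
    holds at a smaller weight on the way, the halving carries it back up. *)
Lemma descent_bound :
  (exists n0, forall (T : finType) (w : T -> T -> nat),
     n0 <= #|T| -> is_15_weight w -> sqprod w <= star_max #|T| ^ 2 \/
     exists (w' : T -> T -> nat) S M, [/\ is_15_weight w', sqprod w <= sqprod w' & light_set w' S M]) ->
  exists n0, forall (T : finType) (w : T -> T -> nat),
     n0 <= #|T| -> is_15_weight w -> sqprod w <= star_max #|T| ^ 2.
Proof.
move=> [na hna]; have [nb hnb] := light_set_descent.
pose n1 := na + nb + 10.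
pose K := 15 ^ (n1 * n1 * 11).
(* The least number of descents, each losing at most five vertices, that lead from n vertices to
   fewer than [n1]; it is 0 below [n1]. *)
pose e n := (n + 5 - n1) %/ 5.
have e_step m n : m < n <= m + 5 -> n1 <= n -> e n <= (e m).+1.
  by rewrite /e; clear; lia.
have halve q q' x y : 0 < x -> 2 * q * x <= q' * y -> q' <= x -> q <= y.
  move=> x0 le_q le_q'; rewrite -(leq_pmul2r x0).
  apply: (@leq_trans (2 * q * x)); first by rewrite -mulnA leq_pmull.
  by apply: (leq_trans le_q); rewrite mulnC leq_mul2l le_q' orbT.
have double q q' x y r r' k : 0 < x -> 2 * q * x <= q' * y ->
    r' * q' <= k * x -> r <= 2 * r' -> r * q <= k * y.
  move=> x0 le_q le_q' le_r; rewrite -(leq_pmul2r x0).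
  apply: (@leq_trans (2 * r' * q * x)); first by rewrite !leq_mul2r le_r !orbT.
  have -> : 2 * r' * q * x = r' * (2 * q * x) by lia.
  apply: (@leq_trans (r' * (q' * y))); first by rewrite leq_mul2l le_q orbT.
  have -> : k * y * x = (k * x) * y by lia.
  by rewrite mulnA leq_mul2r le_q' orbT.
have main n : forall (T : finType) (w : T -> T -> nat), #|T| = n -> 4 <= n ->
    is_15_weight w -> sqprod w <= star_max n ^ 2 \/
    2 ^ e n * sqprod w ^ 11 <= K * (star_max n ^ 2) ^ 11.
  have [k] := ubnP n; elim: k n => // k IHk n lt_nk T w cT n4 hw.
  have [lt_n|le_n] := ltnP n n1.
    right; have -> : e n = 0 by rewrite /e; lia.
    rewrite mul1n; apply: (@leq_trans (K * 1)); last first.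
      by rewrite leq_mul2l !expn_gt0 star_max_gt0 orbT.
    rewrite muln1 /K expnM; apply: leq_expn2r.
    apply: leq_trans (sqprod_le _ hw) _; rewrite cT // leq_pexp2l //.
    by apply: leq_mul; lia.
  have leT : n1 <= #|T| by rewrite cT.
  have naT : na <= #|T| by apply: leq_trans leT; rewrite /n1; lia.
  have nbT : nb <= #|T| by apply: leq_trans leT; rewrite /n1; lia.
  have := hna T w naT hw; rewrite cT => -[|[v [S [M [hv le_wv hS]]]]]; first by left.
  have [T' [w' [hw' cT' le_v]]] := hnb T v S M nbT hv hS.
  have le_w : 2 * sqprod w ^ 11 * (star_max #|T'| ^ 2) ^ 11 <=
              sqprod w' ^ 11 * (star_max #|T| ^ 2) ^ 11.
    apply: leq_trans le_v; apply: leq_mul (leqnn _).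
    exact: (leq_mul (leqnn 2) (leq_expn2r 11 le_wv)).
  rewrite cT in cT' le_w.
  have sn : 0 < (star_max #|T'| ^ 2) ^ 11 by rewrite !expn_gt0 star_max_gt0.
  have lt_T' : #|T'| < k by lia.
  have T'4 : 4 <= #|T'| by rewrite /n1 in le_n; lia.
  have [le'|le'] := IHk #|T'| lt_T' T' w' erefl T'4 hw'.
    left; rewrite -(@leq_exp2r _ _ 11) //.
    apply: (@halve _ (sqprod w' ^ 11) _ _ sn) => //; exact: leq_expn2r.
  right; apply: (@double _ _ _ _ _ _ K sn le_w le').
  by rewrite -expnS leq_pexp2l // e_step.
exists (n1 + 5 * K) => T w Tn hw.
have T4 : 4 <= #|T| by rewrite /n1 in Tn; lia.
have [//|h] := main #|T| T w erefl T4 hw.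
rewrite -(@leq_exp2r _ _ 11) //.
have K0 : 0 < K by rewrite expn_gt0.
have e_ge : K <= 2 ^ e #|T|.
  apply: leq_trans (ltnW (ltn_expl K (isT : 1 < 2))) _.
  by rewrite leq_pexp2l // /e; lia.
rewrite -(leq_pmul2l K0); apply: leq_trans h.
by rewrite leq_mul2r e_ge orbT.
Qed.

End Deletion.

(** * Zykov symmetrization of maximal weights *)

Section Symmetrization.
Set Implicit Arguments.
Unset Strict Implicit.
Local Open Scope nat_scope.

(** Weights form an infinite type, so maximal ones are obtained from a bound on the values. *)
Lemma bounded_max (A : Type) (P : A -> Prop) (f : A -> nat) b :
  (exists a, P a) -> (forall a, P a -> f a <= b) ->
  exists a, P a /\ forall a', P a' -> f a' <= f a.
Proof.
move=> [a0 Pa0] fb; pose p n := `[< exists a, P a /\ f a = n >].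
have [||n /asboolP[a [Pa <-]] max_a] := @ex_maxnP p b.
- by exists (f a0); apply/asboolP; exists a0.
- by move=> n /asboolP[a [Pa <-]]; exact: fb.
by exists a; split=> // a' Pa'; apply: max_a; apply/asboolP; exists a'.
Qed.

(* Weights satisfying the bounds on triples and quadruples even when vertices
   are repeated: this class is stable under reindexing by an arbitrary map. *)
Definition is_reduced (T : finType) (w : T -> T -> nat) :=
  [/\ forall x y, w x y = w y x, forall x, w x x = 1,
      forall x y, 1 <= w x y <= 3,
      forall x y z, w x y + w x z + w y z <= 8 &
      forall x y z t, w x y + w x z + w x t + w y z + w y t + w z t <= 15].

Lemma is_reduced_15 (T : finType) (w : T -> T -> nat) :
  is_reduced w -> is_15_weight w.
Proof. by case=> wC w1 _ _ w15; split. Qed.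

Lemma is_reduced_comp (T T' : finType) (w : T -> T -> nat) (phi : T' -> T) :
  is_reduced w -> is_reduced (fun x y => w (phi x) (phi y)).
Proof. by case=> wC w1 wb w8 w15; split=> *. Qed.

(** Composing a weight with this map turns y into a clone of x. *)
Definition redirect (T : finType) (x y u : T) := if u == y then x else u.

Lemma big_redirect (R : Type) (idx : R) (op : Monoid.com_law idx)
    (T : finType) (F : T -> T -> R) x y : (forall u v, F u v = F v u) ->
  \big[op/idx]_u \big[op/idx]_v F (redirect x y u) (redirect x y v) =
  op (op (F x x) (op (\big[op/idx]_(u | u != y) F u x) (\big[op/idx]_(u | u != y) F u x)))
     (\big[op/idx]_(u | u != y) \big[op/idx]_(v | v != y) F u v).
Proof.
move=> FC; rewrite (big_square_split _ (pred1 y)) //=.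
have redN u : u != y -> redirect x y u = u by rewrite /redirect => /negPf->.
have redy : redirect x y y = x by rewrite /redirect eqxx.
rewrite !big_pred1_eq redy; congr (op (op _ (op _ _)) _).
- by apply: eq_big => u // uy; rewrite big_pred1_eq redy redN.
- by apply: eq_big => u // uy; rewrite big_pred1_eq redy redN.
apply: eq_big => u // uy; apply: eq_big => v // vy; by rewrite !redN.
Qed.

Lemma redirect_id (T : finType) (y u : T) : redirect y y u = u.
Proof. by rewrite /redirect; case: eqP => [->|]. Qed.

Definition clones (T : finType) (w : T -> T -> nat) u v :=
  [forall z, w u z == w v z].

Definition clone_count (T : finType) (w : T -> T -> nat) :=
  \sum_u \sum_v (clones w u v : nat).

Definition maximal15 (T : finType) (w : T -> T -> nat) :=
  is_15_weight w /\ forall w' : T -> T -> nat, is_15_weight w' -> sqprod w' <= sqprod w.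

Section Redirect.
Variables (T : finType) (w : T -> T -> nat).
Hypotheses (w_red : is_reduced w) (w_max : maximal15 w).

Let wC : forall x y, w x y = w y x. Proof. by case: w_red. Qed.
Let w1 : forall x, w x x = 1. Proof. by case: w_red. Qed.

Let sqprod_redirect x y :
  sqprod (fun u v => w (redirect x y u) (redirect x y v)) =
  (\prod_(u | u != y) w u x) ^ 2 * \prod_(u | u != y) \prod_(v | v != y) w u v.
Proof. by rewrite /sqprod big_redirect //= w1 mul1n mulnn. Qed.

Let sqprodE y :
  sqprod w =
  (\prod_(u | u != y) w u y) ^ 2 * \prod_(u | u != y) \prod_(v | v != y) w u v.
Proof.
(* Redirecting y to itself is the identity, so the formula for redirected weights also covers
   [w]. *)
rewrite -sqprod_redirect /sqprod.
by apply: eq_bigr => u _; apply: eq_bigr => v _; rewrite !redirect_id.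
Qed.

Let redirect_le x y : w x y = 1 -> \prod_u w u x <= \prod_u w u y.
Proof.
move=> wxy; have [_ /(_ _ (is_reduced_15 (is_reduced_comp (redirect x y) w_red)))] := w_max.
rewrite sqprod_redirect (sqprodE y) leq_pmul2r ?leq_sqr; last first.
  apply: prodn_gt0 => u; apply: prodn_gt0 => v.
  by have [_ _ + _ _] := w_red => /(_ u v) /andP[].
by move=> le_xy; rewrite (bigD1 y) //= wC wxy mul1n [X in _ <= X](bigD1 y) //= w1 mul1n.
Qed.

(** By [redirect_le] in both directions x and y contribute equal products, so a copy of x can
    replace y without loss. *)
Lemma redirect_maximal x y : w x y = 1 ->
  maximal15 (fun u v => w (redirect x y u) (redirect x y v)).
Proof.
move=> wxy; split; first exact/is_reduced_15/is_reduced_comp.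
have [_ w_le] := w_max => w' /w_le; suff -> : sqprod w =
  sqprod (fun u v => w (redirect x y u) (redirect x y v)) by [].
rewrite sqprod_redirect (sqprodE y); congr (_ ^ 2 * _).
have : \prod_u w u y = \prod_u w u x.
  by apply/eqP; rewrite eqn_leq !redirect_le // wC.
by rewrite (bigD1 y) //= w1 mul1n [RHS](bigD1 y) //= wC wxy mul1n.
Qed.

(** Clone pairs among the other vertices survive. The vertex y trades its former clones for the
    class of x, which does not contain y and is at least as large as the class of y including y
    itself. *)
Lemma clone_count_redirect x y : ~~ clones w x y ->
  \sum_v (clones w y v : nat) <= \sum_v (clones w x v : nat) ->
  clone_count w < clone_count (fun u v => w (redirect x y u) (redirect x y v)).
Proof.
move=> Nxy le_yx.
have cC u v : (clones w u v : nat) = clones w v u.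
  by congr nat_of_bool; apply/forallP/forallP => h z; rewrite eq_sym.
have cc u : clones w u u by apply/forallP.
pose F u v := (clones w u v : nat).
have <- : \sum_u \sum_v F (redirect y y u) (redirect y y v) = clone_count w.
  by apply: eq_bigr => u _; apply: eq_bigr => v _; rewrite !redirect_id.
(* Clones for [w] stay clones after redirection; new ones may arise, so only an inequality is
   claimed. *)
apply: (@leq_trans (\sum_u \sum_v F (redirect x y u) (redirect x y v))); last first.
  apply: leq_sum => u _; apply: leq_sum => v _; rewrite /F.
  have [/forallP h|//] := boolP (clones w (redirect x y u) (redirect x y v)).
  by rewrite lt0b; apply/forallP => z; exact: h.
rewrite !(big_redirect _ _ _ cC) /= ltn_add2r /F !cc ltn_add2l.
move: le_yx; rewrite (bigD1 y) //= cc [X in _ <= X](bigD1 y) //= (negPf Nxy).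
under eq_bigr => v _ do rewrite cC.
under [X in _ <= _ + X]eq_bigr => v _ do rewrite cC.
lia.
Qed.

End Redirect.

(* Zykov symmetrization: redirecting y to x when w x y = 1 cannot change the
   product of a maximal weight, so a maximal weight with the most pairs of
   clones has w x y = 1 only between clones. *)
Lemma maximal_cloned (T : finType) :
  4 <= #|T| -> (exists w : T -> T -> nat, is_15_weight w) ->
  (forall w : T -> T -> nat, maximal15 w -> is_reduced w) ->
  exists w : T -> T -> nat,
    maximal15 w /\ forall x y, w x y = 1 -> forall z, w x z = w y z.
Proof.
move=> T4 ex_w red.
have [w0 w0max] := bounded_max ex_w (fun w => sqprod_le T4).
have cc_le (w : T -> T -> nat) : maximal15 w -> clone_count w <= #|T| * #|T|.
  move=> _; apply: (@leq_trans (\sum_(u : T) \sum_(v : T) 1)).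
    by apply: leq_sum => u _; apply: leq_sum => v _; exact: leq_b1.
  by rewrite !sum_nat_const muln1.
have [w [wmax w_cc]] := bounded_max (ex_intro _ w0 w0max) cc_le.
exists w; split=> // x y wxy z; apply/eqP; move: z; apply/forallP.
apply: contraT => Nxy; have wred := red w wmax.
have [wC _ _ _ _] := wred.
have Nyx : ~~ clones w y x.
  by apply: contra Nxy => /forallP h; apply/forallP => z; rewrite eq_sym.
wlog le_yx : x y wxy Nxy Nyx / \sum_v (clones w y v : nat) <= \sum_v (clones w x v : nat).
  move=> wl; case: (leqP (\sum_v (clones w y v : nat)) (\sum_v (clones w x v : nat))).
    exact: wl.
  by move/ltnW; apply: wl => //; rewrite wC.
have := clone_count_redirect Nxy le_yx.
by rewrite ltnNge (w_cc _ (redirect_maximal wred wmax wxy)).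
Qed.

End Symmetrization.

(** * Structure of weights without light sets *)

Section Heavy.
Set Implicit Arguments.
Unset Strict Implicit.
Local Open Scope nat_scope.

Definition is_heavy (T : finType) (w : T -> T -> nat) :=
  forall S M, ~ light_set w S M.

Lemma heavyP (T : finType) (w : T -> T -> nat) (S : seq T) M :
  is_heavy w -> uniq S -> 0 < size S <= 5 -> M ^ 11 * 6 <= 5 * 3 ^ (8 * size S) ->
  exists u, u \notin S /\ M < \prod_(s <- S) w s u.
Proof.
move=> hw uS sS hM.
have [/existsP[u /andP[uS' lt_u]]|/existsPn h] :=
  boolP [exists u, (u \notin S) && (M < \prod_(s <- S) w s u)]; first by exists u.
case: (hw S M); split=> // u uS'.
by have := h u; rewrite uS' /= -leqNgt.
Qed.

(** Thresholds for a vertex, an edge, a triple, a four-vertex path or matching, and a pentagon, in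
    this order. *)
Lemma light_2_1 : 2 ^ 11 * 6 <= 5 * 3 ^ (8 * 1). Proof. lia. Qed.
Lemma light_4_2 : 4 ^ 11 * 6 <= 5 * 3 ^ (8 * 2). Proof. lia. Qed.
Lemma light_8_3 : 8 ^ 11 * 6 <= 5 * 3 ^ (8 * 3). Proof. lia. Qed.
Lemma light_24_4 : 24 ^ 11 * 6 <= 5 * 3 ^ (8 * 4). Proof. lia. Qed.
Lemma light_48_5 : 48 ^ 11 * 6 <= 5 * 3 ^ (8 * 5). Proof. lia. Qed.

Lemma mul3_le8 a b c : a + b + c <= 6 -> a * b * c <= 8.
Proof.
by case: a => [|[|[|[|[|[|[|a]]]]]]]; case: b => [|[|[|[|[|[|[|b]]]]]]]; lia.
Qed.

Section Reduction.
Variables (T : finType) (w : T -> T -> nat).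
Hypotheses (w15 : is_15_weight w) (w_heavy : is_heavy w) (w_gt0 : 0 < sqprod w).

(** A triple weighing at least 9 leaves at most 6 for its weights to a fourth vertex, hence a
    product of at most 8: it is light. *)
Let triple_le x y z : uniq [:: x; y; z] -> w x y + w x z + w y z <= 8.
Proof.
move=> uS; rewrite leqNgt; apply/negP => lt8.
have [u [uS' lt_u]] := heavyP w_heavy uS isT light_8_3.
have [wC _ /(_ u x y z)] := w15.
rewrite cons_uniq uS uS' => /(_ isT); rewrite !(wC u).
move: lt_u; rewrite !big_cons big_nil muln1 mulnA => lt_u le15.
have : w x u + w y u + w z u <= 6 by lia.
by move=> /mul3_le8; rewrite leqNgt lt_u.
Qed.

(** For an edge of weight at least 4, [triple_le] leaves a sum of at most 4 to any third vertex,
    hence a product of at most 4: the edge is light. *)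
Let le3 x y : w x y <= 3.
Proof.
have [wC w1 _] := w15.
have [->|xy] := eqVneq x y; first by rewrite w1.
rewrite leqNgt; apply/negP => lt3.
have uS : uniq [:: x; y] by rewrite /= inE xy.
have [u [uS' lt_u]] := heavyP w_heavy uS isT light_4_2.
have := @triple_le u x y; rewrite cons_uniq uS uS' => /(_ isT); rewrite !(wC u).
move: lt_u; rewrite !big_cons big_nil muln1 => lt_u le8.
have : w x u + w y u + 1 <= 5 by lia.
by case: (w x u) lt_u => [|[|[|[|[|a]]]]]; case: (w y u) => [|[|[|[|[|b]]]]]; lia.
Qed.

Lemma heavy_reduced : is_reduced w.
Proof.
have [wC w1 wq] := w15.
have ge1 x y : 1 <= w x y.
  by move: w_gt0 => /gt0_prodn/(_ x isT)/gt0_prodn/(_ y isT).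
have t8 x y z : w x y + w x z + w y z <= 8.
  have [uS|] := boolP (uniq [:: x; y; z]); first exact: triple_le.
  have := (le3 x y, le3 x z, le3 y z) => -[[a b] c].
  rewrite /= !inE andbT negb_and !negbK -orbA.
  by case/or3P => /eqP e; subst; rewrite ?w1 in a b c *; lia.
(* Quadruples with x repeated: the triple gives at most 8, the two duplicated edges at most 3 each,
   the diagonal 1. *)
have t15 x y z : 1 + 2 * (w x y + w x z) + w y z <= 15.
  by have := (t8 x y z, le3 x y, le3 x z, ge1 y z) => -[[[]]]; lia.
split=> // [x y|x y z t]; first by rewrite ge1 le3.
have [uS|] := boolP (uniq [:: x; y; z; t]); first exact: wq.
rewrite /= !inE andbT !negb_and !negbK -!orbA.
case/or4P => [/eqP e|/eqP e|/eqP e|/or3P[]/eqP e]; subst; rewrite ?w1.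
- by have := t15 y z t; lia.
- by have := t15 z y t; rewrite (wC y z); lia.
- by have := t15 t y z; rewrite (wC y t) (wC z t); lia.
- by have := t15 z x t; rewrite (wC x z); lia.
- by have := t15 t x z; rewrite (wC x t) (wC z t); lia.
- by have := t15 t x y; rewrite (wC x t) (wC y t); lia.
Qed.

End Reduction.

(** At most one factor is 3, so 3 * 2 * 2 * 2 is the extreme case. *)
Lemma prod4_le24 p q r s :
  [\/ p = 1, p = 2 | p = 3] -> [\/ q = 1, q = 2 | q = 3] ->
  [\/ r = 1, r = 2 | r = 3] -> [\/ s = 1, s = 2 | s = 3] ->
  p + q <= 5 -> p + r <= 5 -> p + s <= 5 -> q + r <= 5 -> q + s <= 5 ->
  r + s <= 5 -> p * (q * (r * s)) <= 24.
Proof. by case=> ->; case=> ->; case=> ->; case=> ->; lia. Qed.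

Section Structure.
Variables (T : finType) (w : T -> T -> nat).
Hypotheses (w_red : is_reduced w) (w_heavy : is_heavy w).
Hypothesis w_clone : forall x y, w x y = 1 -> forall z, w x z = w y z.

Let wC x y : w x y = w y x. Proof. by case: w_red. Qed.
Let w1 x : w x x = 1. Proof. by case: w_red. Qed.
Let tri x y z : w x y + w x z + w y z <= 8. Proof. by case: w_red. Qed.

Let valP x y : [\/ w x y = 1, w x y = 2 | w x y = 3].
Proof.
have [_ _ /(_ x y) + _ _] := w_red.
by case: (w x y) => [|[|[|[|n]]]] // _; [apply: Or31|apply: Or32|apply: Or33].
Qed.

Let neq x y : w x y <> 1 -> x != y.
Proof. by move=> h; apply/eqP => e; apply: h; rewrite e. Qed.

(** The four sides use up 12 of the 15. *)
Let square x y z t : w x y = 3 -> w y z = 3 -> w z t = 3 -> w t x = 3 ->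
  w x z = 1 \/ w y t = 1.
Proof.
have [_ _ _ _ /(_ x y z t)] := w_red; rewrite (wC t x).
by case: (valP x z) (valP y t) => ->; case=> ->; lia.
Qed.

Let no_triangle x y z : w x y = 3 -> w x z = 3 -> w y z = 3 -> False.
Proof. by have := tri x y z; lia. Qed.

(** A chord of weight 1 would make a and c clones and create the triangle a, d, e; a chord of weight
    3 closes the triangle a, b, c. *)
Let chord a b c d e : w a b = 3 -> w b c = 3 -> w c d = 3 -> w d e = 3 -> w e a = 3 ->
  w a c = 2.
Proof.
move=> ab bc cd de ea; case: (valP a c) => // ac.
  by case: (no_triangle (etrans (w_clone ac d) cd) (etrans (wC a e) ea) de).
by case: (no_triangle ab ac bc).
Qed.

Let clone_at x u y : w x u = 1 -> w y u = w y x.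
Proof. by move=> xu; rewrite !(wC y) (w_clone xu). Qed.

Let sum_le5 x y u : ~ (w x u = 3 /\ w y u = 3) -> w x u + w y u <= 5.
Proof. by case: (valP x u) (valP y u) => ->; case=> -> // []. Qed.

Let adj_le5 x y u : w x y = 3 -> w x u + w y u <= 5.
Proof. by move=> xy; apply: sum_le5 => -[xu yu]; exact: no_triangle xy xu yu. Qed.

(** Two weights 3 at u would close a 4-cycle with neither diagonal equal to 1, against [square]. *)
Let dist2_le5 x y z u :
  w x y = 3 -> w y z = 3 -> w x z = 2 -> w y u <> 1 -> w x u + w z u <= 5.
Proof.
move=> xy yz xz yu; apply: sum_le5 => -[xu zu].
by case: (square xy yz zu (etrans (wC u x) xu)); rewrite ?xz.
Qed.

Let uniq5 a b c d e :
  w a b <> 1 -> w a c <> 1 -> w a d <> 1 -> w a e <> 1 -> w b c <> 1 ->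
  w b d <> 1 -> w b e <> 1 -> w c d <> 1 -> w c e <> 1 -> w d e <> 1 ->
  uniq [:: a; b; c; d; e].
Proof. by move=> *; rewrite /= !inE !negb_or !neq. Qed.

(** The pentagon would be light. A clone of one of its vertices has product 1 * 3 * 3 * 2 * 2 = 36;
    for any other u all weights are 2 or 3 and at most one is 3, so the product is at most 48. *)
Let no_pentagon a b c d e :
  w a b = 3 -> w b c = 3 -> w c d = 3 -> w d e = 3 -> w e a = 3 -> False.
Proof.
move=> ab bc cd de ea.
have ac := chord ab bc cd de ea; have bd := chord bc cd de ea ab.
have ce := chord cd de ea ab bc; have da := chord de ea ab bc cd.
have eb := chord ea ab bc cd de.
have [ba cb dc ed ae] : [/\ w b a = 3, w c b = 3, w d c = 3, w e d = 3 & w a e = 3].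
  by split; rewrite wC.
have [ca db ec ad be] : [/\ w c a = 2, w d b = 2, w e c = 2, w a d = 2 & w b e = 2].
  by split; rewrite wC.
have uS : uniq [:: a; b; c; d; e] by apply: uniq5; lia.
have [u [_]] := heavyP w_heavy uS isT light_48_5.
rewrite !big_cons big_nil muln1 ltnNge => /negP; apply.
case: (valP a u) => au; first by rewrite au !(clone_at _ au) ba ca da ea.
all: case: (valP b u) => bu; first by rewrite bu !(clone_at _ bu) ab cb db eb.
all: case: (valP c u) => cu; first by rewrite cu !(clone_at _ cu) ac bc dc ec.
all: case: (valP d u) => du; first by rewrite du !(clone_at _ du) ad bd cd ed.
all: case: (valP e u) => eu; first by rewrite eu !(clone_at _ eu) ae be ce de.
all: move: (adj_le5 u ab) (adj_le5 u bc) (adj_le5 u cd) (adj_le5 u de) (adj_le5 u ea).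
all: have := @dist2_le5 a b c u ab bc ac; have := @dist2_le5 b c d u bc cd bd.
all: have := @dist2_le5 c d e u cd de ce; have := @dist2_le5 d e a u de ea da.
all: have := @dist2_le5 e a b u ea ab eb.
all: rewrite au bu cu du eu; lia.
Qed.

(** The last two hypotheses exclude walks that fold back onto a clone. The other three weights are
    then 2, and the four vertices are light: outside their clones, two weights 3 at u would give a
    triangle, a forbidden 4-cycle or, at both ends, a pentagon. *)
Let no_path c a b d : w c a = 3 -> w a b = 3 -> w b d = 3 ->
  w c b <> 1 -> w a d <> 1 -> False.
Proof.
move=> ca ab bd cb1 ad1.
have cb : w c b = 2.
  by case: (valP c b) => // cb; case: (no_triangle ca cb ab).
have ad : w a d = 2.
  by case: (valP a d) => // ad; case: (no_triangle ab ad bd).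
have cd : w c d = 2.
  case: (valP c d) => // cd; first by move: (w_clone cd a); rewrite ca wC ad.
  by case: (square ca ab bd (etrans (wC d c) cd)); rewrite ?cb ?ad.
have [ac ba db] : [/\ w a c = 3, w b a = 3 & w d b = 3] by split; rewrite wC.
have [bc da dc] : [/\ w b c = 2, w d a = 2 & w d c = 2] by split; rewrite wC.
have uS : uniq [:: c; a; b; d] by rewrite /= !inE !negb_or !neq; lia.
have [u [_]] := heavyP w_heavy uS isT light_24_4.
rewrite !big_cons big_nil muln1 ltnNge => /negP; apply.
have [cu|cu] := eqVneq (w c u) 1; first by rewrite cu !(clone_at _ cu) ac bc dc.
have [au|au] := eqVneq (w a u) 1; first by rewrite au !(clone_at _ au) ca ba da.
have [bu|bu] := eqVneq (w b u) 1; first by rewrite bu !(clone_at _ bu) cb ab db.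
have [du|du] := eqVneq (w d u) 1; first by rewrite du !(clone_at _ du) cd ad bd.
apply: prod4_le24; try exact: valP.
- exact: adj_le5.
- by apply: (dist2_le5 ca ab cb); apply/eqP.
- apply: sum_le5 => -[cu3 du3].
  by apply: (no_pentagon ca ab bd du3); rewrite wC.
- exact: adj_le5.
- by apply: (dist2_le5 ab bd ad); apply/eqP.
- exact: adj_le5.
Qed.

(** The four vertices would be light: two weights 3 at u give a triangle if they go to the same
    edge, a three-edge path otherwise. *)
Let no_matching a b c d : w a b = 3 -> w c d = 3 ->
  w a c = 2 -> w a d = 2 -> w b c = 2 -> w b d = 2 -> False.
Proof.
move=> ab cd ac ad bc bd.
have [ba dc] : w b a = 3 /\ w d c = 3 by split; rewrite wC.
have [ca da cb db] : [/\ w c a = 2, w d a = 2, w c b = 2 & w d b = 2].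
  by split; rewrite wC.
have uS : uniq [:: a; b; c; d] by rewrite /= !inE !negb_or !neq; lia.
have [u [_]] := heavyP w_heavy uS isT light_24_4.
rewrite !big_cons big_nil muln1 ltnNge => /negP; apply.
have [au|/eqP au] := eqVneq (w a u) 1; first by rewrite au !(clone_at _ au) ba ca da.
have [bu|/eqP bu] := eqVneq (w b u) 1; first by rewrite bu !(clone_at _ bu) ab cb db.
have [cu|/eqP cu] := eqVneq (w c u) 1; first by rewrite cu !(clone_at _ cu) ac bc dc.
have [du|/eqP du] := eqVneq (w d u) 1; first by rewrite du !(clone_at _ du) ad bd cd.
have cross x y z : w x y = 3 -> w x z = 2 -> w y u <> 1 -> w x u + w z u <= 5.
  move=> xy xz yu; apply: sum_le5 => -[xu zu].
  by apply: (@no_path y x u z); rewrite ?xz // wC.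
apply: prod4_le24; try exact: valP.
- exact: adj_le5.
- exact: cross ab ac bu.
- exact: cross ab ad bu.
- exact: cross ba bc au.
- exact: cross ba bd au.
- exact: adj_le5.
Qed.

(** The set [A], in the role of L, consists of the clones of a centre a. Every other vertex has
    weight 3 to a, so two of them have weight at most 2, there being no triangle. *)
Lemma reduced_star (a0 : T) : exists A : {set T}, forall x y,
  w x y <= if x \in A then (if y \in A then 1 else 3) else (if y \in A then 3 else 2).
Proof.
have nbr v : exists v', w v v' = 3.
  have uS : uniq [:: v] by [].
  have [u [_]] := heavyP w_heavy uS isT light_2_1.
  rewrite big_cons big_nil muln1 => vu; exists u.
  by case: (valP v u) vu => ->.
have [b0 ab0] := nbr a0.
have cover a b v : w a b = 3 -> [\/ w v a = 1, w v b = 1, w v a = 3 | w v b = 3].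
  move=> ab; case: (valP v a) => va; [by apply: Or41| |by apply: Or43].
  case: (valP v b) => vb; [by apply: Or42| |by apply: Or44].
  (* Here v has weight 2 to a and b, so v' is a clone of neither. The edge vv' then forms with ab a
     matching or part of a three-edge path. *)
  exfalso; have [v' vv'] := nbr v.
  case: (valP v' a) => v'a.
  - by move: (w_clone v'a v); rewrite wC vv' wC va.
  - case: (valP v' b) => v'b.
    + by move: (w_clone v'b v); rewrite wC vv' wC vb.
    + by apply: (no_matching ab vv'); rewrite wC.
    + by apply: (@no_path a b v' v); rewrite // 1?wC // ?v'a ?vb.
  - apply: (@no_path b a v' v); rewrite // 1?wC // ?va //.
    by move=> /w_clone/(_ v); rewrite (wC v') vv' (wC b) vb.
(* If a0 has a neighbour that is no clone of b0, then all neighbours of b0 are clones of a0, since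
   otherwise a three-edge path appears. If it has none, b0 is the centre. *)
have [a [b [ab leaf]]] : exists a b, w a b = 3 /\ forall d, w d b = 3 -> w d a = 1.
  have [/existsP[c /andP[/eqP ca cb]]|/existsPn Nc] :=
    boolP [exists c, (w c a0 == 3) && (w c b0 != 1)]; last first.
    exists b0, a0; split=> [|d da]; first by rewrite wC.
    by have := Nc d; rewrite da /= negbK => /eqP.
  exists a0, b0; split=> // d db; apply/eqP; apply: contraT => /eqP da.
  exfalso; apply: (@no_path c a0 b0 d) => //; [by rewrite wC|exact/eqP|by rewrite wC].
exists [set v | w v a == 1].
have out v : w v a != 1 -> w v a = 3.
  move=> va; case: (cover a b v ab) => // [/eqP|vb|/leaf/eqP]; rewrite ?(negPf va) //.
  by rewrite (w_clone vb a) wC.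
move=> x y; rewrite !inE.
have [xa|xa] := eqVneq (w x a) 1; have [ya|ya] := eqVneq (w y a) 1.
- by rewrite (w_clone xa) wC ya.
- by case: (valP x y) => ->.
- by case: (valP x y) => ->.
- case: (valP x y) => // [->|->|xy] //.
  by case: (no_triangle xy (out x xa) (out y ya)).
Qed.

End Structure.
End Heavy.

(** * The extremal bound for weights on large vertex sets *)

Section Combinatorics.
Set Implicit Arguments.
Unset Strict Implicit.
Local Open Scope nat_scope.

Definition star_weight (T : finType) (A : {set T}) (x y : T) :=
  if x == y then 1 else
  if x \in A then (if y \in A then 1 else 3) else (if y \in A then 3 else 2).

Lemma sqprod_star_weight (T : finType) (A : {set T}) :
  sqprod (star_weight A) = star_prod #|A| (#|T| - #|A|) ^ 2.
Proof.
set b := #|T| - #|A|.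
have cN : #|[predC A]| = b by rewrite /b -(cardC A) addKn.
have sC x y : star_weight A x y = star_weight A y x.
  by rewrite /star_weight eq_sym; case: (x \in A); case: (y \in A).
rewrite /sqprod (big_square_split _ (mem A)) //= mulnn.
rewrite big1 ?mul1n => [|x xA]; last first.
  by rewrite big1 // => y yA; rewrite /star_weight xA yA if_same.
have -> : \prod_(x | x \notin A) \prod_(y in A) star_weight A x y = 3 ^ (#|A| * b).
  transitivity (\prod_(x in [predC A]) 3 ^ #|A|); last by rewrite prod_nat_const cN -expnM.
  apply: eq_bigr => x xA; rewrite -prod_nat_const; apply: eq_bigr => y yA.
  rewrite /star_weight yA (negPf xA); case: eqP => // xy.
  by rewrite xy yA in xA.
have -> : \prod_(x | x \notin A) \prod_(y | y \notin A) star_weight A x y = 2 ^ (b * b.-1).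
  transitivity (\prod_(x in [predC A]) 2 ^ b.-1).
    apply: eq_bigr => x xA; rewrite (bigD1 x) //= /star_weight eqxx mul1n.
    rewrite -cN (cardD1 x) inE /= xA /= -prod_nat_const; apply: eq_big => [y|y].
      by rewrite !inE andbC.
    by move=> /andP[/negPf-> /negPf yx]; rewrite (negPf xA) eq_sym yx.
  by rewrite prod_nat_const cN -expnM mulnC.
rewrite /star_prod expnMn -!expnM; congr (_ * 2 ^ _).
by have := mul_bin_diag b 1; rewrite bin1; lia.
Qed.

Lemma star_weight_15 (T : finType) (A : {set T}) : is_15_weight (star_weight A).
Proof.
rewrite /star_weight; split=> [x y|x|x y z t]; last 2 first.
- by rewrite eqxx.
- rewrite /= !inE !negb_or => /and4P[/and3P[/negPf-> /negPf-> /negPf->]].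
  move=> /andP[/negPf-> /negPf->] /negPf-> _.
  by case: (x \in A); case: (y \in A); case: (z \in A); case: (t \in A).
by rewrite eq_sym; case: (x \in A); case: (y \in A).
Qed.

(** A light set may be found in any weight doing at least as well as [w]. If none exists, all
    maximal weights are heavy, so symmetrization can move freely among them. *)
Lemma sqprod_le_star_max : exists n0, forall (T : finType) (w : T -> T -> nat),
  n0 <= #|T| -> is_15_weight w -> sqprod w <= star_max #|T| ^ 2.
Proof.
apply: descent_bound; exists 4 => T w T4 w15.
have [le_w|/negP] := pselect (sqprod w <= star_max #|T| ^ 2); first by left.
rewrite -ltnNge => lt_w.
have [h|no_light] := pselect (exists (w' : T -> T -> nat) S M,
  [/\ is_15_weight w', sqprod w <= sqprod w' & light_set w' S M]); first (right; exact: h).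
left; have heavy (w' : T -> T -> nat) : maximal15 w' -> is_heavy w'.
  by move=> [w'15 /(_ w w15) le_w] S M hS; apply: no_light; exists w', S, M.
(* The positivity needed by [heavy_reduced] comes from assuming that [w] exceeds the bound. *)
have red (w' : T -> T -> nat) : maximal15 w' -> is_reduced w'.
  move=> w'max; have [w'15 /(_ w w15) le_w] := w'max.
  by apply: heavy_reduced (heavy w' w'max) _ => //; apply: leq_trans le_w; lia.
have [|w' [w'max w'_clone]] := maximal_cloned T4 _ red; first by exists w.
have /card_gt0P[a0 _] : 0 < #|T| by apply: leq_trans T4.
have [A leA] := reduced_star (red w' w'max) (heavy w' w'max) w'_clone a0.
have [_ /(_ w w15) le_w] := w'max; apply: leq_trans le_w _.
apply: (@leq_trans (sqprod (star_weight A))).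
  apply: leq_prod => x _; apply: leq_prod => y _; rewrite /star_weight.
  have [->|_] := eqVneq x y; last exact: leA.
  by have [_ -> //] := red w' w'max.
rewrite sqprod_star_weight leq_sqr.
by have := star_prod_le_max #|A| (#|T| - #|A|); rewrite subnKC // max_card.
Qed.

End Combinatorics.

(** * Translation between multigraphs and symmetric weights *)

Section Multigraphs.
Set Implicit Arguments.
Unset Strict Implicit.
Local Open Scope nat_scope.

(** Extends an edge function to ordered pairs, with [d] on the diagonal: 1 for products, 0 for
    sums. *)
Definition over_pair (V : finType) (R : Type) (d : R) (F : pairs V -> R) (x y : V) : R :=
  oapp F d (insub [set x; y]%SET).

Lemma over_pairC V R d F x y : @over_pair V R d F x y = over_pair d F y x.
Proof. by rewrite /over_pair finset.setUC. Qed.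

Lemma over_pairxx V R d F x : @over_pair V R d F x x = d.
Proof. by rewrite /over_pair insubF //= finset.setUid cards1. Qed.

Lemma over_pairE V R d F x y (e : pairs V) :
  val e = [set x; y]%SET -> @over_pair V R d F x y = F e.
Proof. by rewrite /over_pair => <-; rewrite valK. Qed.

Lemma over_pairNE V R d d' F x y : x != y -> @over_pair V R d F x y = over_pair d' F x y.
Proof.
by move=> xy; rewrite /over_pair; case: insubP => //=; rewrite cards2 xy.
Qed.

(** Each edge comes from exactly two ordered pairs, and the diagonal contributes the neutral
    element. *)
Lemma big_over_pair (R : Type) (idx : R) (op : Monoid.com_law idx) (V : finType)
    (F : pairs V -> R) :
  \big[op/idx]_x \big[op/idx]_y over_pair idx F x y =
  op (\big[op/idx]_e F e) (\big[op/idx]_e F e).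
Proof.
rewrite pair_big /= -big_split /=.
have over_sum p : over_pair idx F p.1 p.2 =
    \big[op/idx]_(e : pairs V | val e == [set p.1; p.2]%SET) F e.
  have [/eqP c2|xx] := eqVneq #|[set p.1; p.2]%SET| 2; last first.
    rewrite /over_pair insubF ?(negPf xx) //= big_pred0 // => e.
    by apply: contra_neqF xx => /eqP <-; exact/eqP/(valP e).
  pose e0 : pairs V := Sub [set p.1; p.2]%SET c2.
  by rewrite (big_pred1 e0) => [|e]; [exact: over_pairE|rewrite -val_eqE].
under eq_bigr => p _ do rewrite over_sum.
rewrite (exchange_big_dep predT) //=; apply: eq_bigr => e _.
have /cards2P[a [b [ab ->]]] := valP e.
rewrite (bigD1 (a, b)) //= (bigD1 (b, a)) /=; last first.
  by rewrite finset.setUC eqxx xpair_eqE eq_sym (negPf ab).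
rewrite big_pred0 ?Monoid.mulm1 // => -[x y] /=; rewrite !xpair_eqE.
apply/negP => /andP[/andP[/eqP e2 Nab] Nba].
have xab : x \in [set a; b]%SET by rewrite e2 finset.set21.
have yab : y \in [set a; b]%SET by rewrite e2 finset.set22.
have : a \in [set x; y]%SET by rewrite -e2 finset.set21.
have : b \in [set x; y]%SET by rewrite -e2 finset.set22.
move: xab yab; rewrite !inE {e2}.
by move=> /orP[]/eqP ? /orP[]/eqP ? /orP[]/eqP ? /orP[]/eqP ?; subst;
  rewrite ?eqxx in ab Nab Nba.
Qed.

Definition edge_weight (V : finType) (G : multigraph V) : V -> V -> nat := over_pair 1 G.

Lemma Pprod_sq (V : finType) (G : multigraph V) : Pprod G ^ 2 = sqprod (edge_weight G).
Proof. by rewrite /sqprod big_over_pair /= mulnn. Qed.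

Lemma weight_in_double (V : finType) (G : multigraph V) (X : {set V}) :
  (weight_in G X).*2 = \sum_(x in X) \sum_(y in X) over_pair 0 G x y.
Proof.
pose F (e : pairs V) := if val e \subset X then G e else 0.
have -> : weight_in G X = \sum_e F e by rewrite /weight_in big_mkcond.
rewrite -addnn -big_over_pair [RHS]big_mkcond; apply: eq_bigr => x _.
have FE y : over_pair 0 F x y = if [set x; y]%SET \subset X then over_pair 0 G x y else 0.
  rewrite /over_pair; case: insubP => [e _ <-|_] /=; first by [].
  by rewrite if_same.
under eq_bigr => y _ do rewrite FE finset.subUset !finset.sub1set.
by case: (x \in X) => /=; [rewrite -big_mkcond|rewrite big1].
Qed.

Lemma weight_in_quad (V : finType) (G : multigraph V) x y z t : uniq [:: x; y; z; t] ->
  weight_in G [set v in [:: x; y; z; t]]%SET =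
  edge_weight G x y + edge_weight G x z + edge_weight G x t +
  edge_weight G y z + edge_weight G y t + edge_weight G z t.
Proof.
move=> uS; apply: double_inj; rewrite weight_in_double.
have sumS (F : V -> nat) : \sum_(v in [set v in [:: x; y; z; t]]%SET) F v =
    F x + (F y + (F z + F t)).
  by rewrite big_set -big_uniq //= !big_cons big_nil addn0.
rewrite !sumS !over_pairxx.
move: uS; rewrite /= !inE !negb_or => /and4P[/and3P[xy xz xt] /andP[yz yt] zt _].
rewrite (over_pairC 0 _ y x) (over_pairC 0 _ z x) (over_pairC 0 _ z y).
rewrite (over_pairC 0 _ t x) (over_pairC 0 _ t y) (over_pairC 0 _ t z).
rewrite /edge_weight !(over_pairNE 1 0) //; lia.
Qed.

Lemma sq_graph_15 (V : finType) (G : multigraph V) :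
  is_sq_graph 4 15 G <-> is_15_weight (edge_weight G).
Proof.
split=> [hG|[_ _ hG] X cX]; last first.
  have eX : X = [set v in enum X]%SET by apply/finset.setP => v; rewrite inE mem_enum.
  move: (enum_uniq X) (cX) eX; rewrite cardE.
  case: (enum X) => [|x [|y [|z [|t [|? ?]]]]] // uS _ ->.
  by rewrite weight_in_quad // hG.
split=> [x y|x|x y z t uS]; [exact: over_pairC|exact: over_pairxx|].
rewrite -weight_in_quad //; apply: hG.
by rewrite cardsE; move/card_uniqP: uS.
Qed.

Lemma WsetP n (G : multigraph 'I_n) : Wset n G ->
  exists A, edge_weight G =2 star_weight A.
Proof.
case=> L [R [LR dLR hG]]; exists L => x y; rewrite /star_weight.
have [->|xy] := eqVneq x y; first exact: over_pairxx.
have c2 : #|[set x; y]%SET| == 2 by rewrite cards2 xy.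
have inR v : v \notin L -> v \in R.
  move=> vL; have : v \in L :|: R by rewrite LR finset.in_setT.
  by rewrite finset.in_setU (negPf vL).
pose e0 : pairs 'I_n := Sub [set x; y]%SET c2.
rewrite /edge_weight (@over_pairE _ _ _ _ x y e0) //.
have [h11 h22 h13] := hG e0 x y erefl.
have [_ _ h31] := hG e0 y x (finset.setUC _ _).
by have [xL|/inR xR] := boolP (x \in L); have [yL|/inR yR] := boolP (y \in L); auto.
Qed.

Lemma Wset_star n (A : {set 'I_n}) :
  exists2 G, Wset n G & edge_weight G =2 star_weight A.
Proof.
pose G : multigraph 'I_n := [ffun e : pairs 'I_n =>
  if val e \subset A then 1 else if val e \subset ~: A then 2 else 3].
have GW : Wset n G.
  exists A, (~: A); split=> [||e x y xye]; first exact: finset.setUCr.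
    by rewrite -finset.setI_eq0 finset.setICr.
  have {}xye : val e = [set x; y]%SET := xye.
  split=> xA yA; rewrite ffunE xye !finset.subUset !finset.sub1set !inE.
  - by rewrite xA yA.
  - by move: xA yA; rewrite !inE => /negPf-> /negPf->.
  - by move: yA; rewrite inE xA => /negPf->.
exists G => //; have [B hB] := WsetP GW; move=> x y.
rewrite /star_weight; have [->|xy] := eqVneq x y; first exact: over_pairxx.
have c2 : #|[set x; y]%SET| == 2 by rewrite cards2 xy.
pose e0 : pairs 'I_n := Sub [set x; y]%SET c2.
rewrite /edge_weight (@over_pairE _ _ _ _ x y e0) // ffunE /= !finset.subUset !finset.sub1set !inE.
by case: (x \in A); case: (y \in A).
Qed.

Lemma Pprod_star n (G : multigraph 'I_n) A : edge_weight G =2 star_weight A ->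
  Pprod G = star_prod #|A| (n - #|A|).
Proof.
move=> GA; apply/eqP; rewrite -(@eqn_exp2r _ _ 2) // Pprod_sq.
have := sqprod_star_weight A; rewrite card_ord => <-; apply/eqP.
by apply: eq_bigr => x _; apply: eq_bigr => y _.
Qed.

Lemma Wset_Fset n (G : multigraph 'I_n) : Wset n G -> Fset n 4 15 G.
Proof.
move=> /WsetP[A GA]; apply/sq_graph_15; have [sC s1 s15] := star_weight_15 A.
by split=> [x y|x|x y z t]; rewrite !GA //; exact: s15.
Qed.

Lemma Wset_le n (G : multigraph 'I_n) : Wset n G -> Pprod G <= star_max n.
Proof.
move=> /WsetP[A /Pprod_star->].
have := star_prod_le_max #|A| (n - #|A|); have := max_card A.
by rewrite card_ord => leA; rewrite subnKC.
Qed.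

Lemma Wset_attained n : exists2 G, Wset n G & Pprod G = star_max n.
Proof.
have [a [b [ab ->]]] := star_max_attained n.
pose A := [set i : 'I_n | i < a]%SET.
have cA : #|A| = a.
  rewrite cardsE -sum1_card -(big_ord_widen n (fun _ => 1)) ?sum1_card ?card_ord //.
  by rewrite -ab leq_addr.
have [G GW /Pprod_star eG] := Wset_star A.
by exists G => //; rewrite eG cA -ab addKn.
Qed.

Lemma Wset_maximizes n (G : multigraph 'I_n) :
  maximizes (Wset n) G <-> Wset n G /\ Pprod G = star_max n.
Proof.
split=> [[GW Gmax]|[GW eG]]; split=> //; last by move=> H /Wset_le; rewrite eG.
have [H HW eH] := Wset_attained n.
by apply/eqP; rewrite eqn_leq Wset_le //= -eH Gmax.
Qed.

(** All maximizers share one value, so [xget] returns it and not its default. *)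
Lemma maxPE (V : finType) (A : multigraph V -> Prop) G : maximizes A G -> maxP A = Pprod G.
Proof.
move=> Gmax; apply: xget_subset1; first by exists G.
move=> _ _ [H Hmax ->] [K Kmax ->]; apply/eqP; rewrite eqn_leq.
by case: Hmax Kmax => HA leH [KA leK]; rewrite leH // leK.
Qed.

Lemma maxP_Wset n : maxP (Wset n) = star_max n.
Proof. by have [G GW eG] := Wset_attained n; rewrite -eG; apply/maxPE/Wset_maximizes. Qed.

Lemma Wset_maximizes_Fset : exists n0, forall n (G : multigraph 'I_n), n0 <= n ->
  maximizes (Wset n) G -> maximizes (Fset n 4 15) G.
Proof.
have [n0 h] := sqprod_le_star_max; exists n0 => n G le_n /Wset_maximizes[GW eG].
split=> [|H /sq_graph_15 HF]; first exact: Wset_Fset.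
by rewrite -leq_sqr Pprod_sq eG; have := h _ _ _ HF; rewrite card_ord; exact.
Qed.

End Multigraphs.

(** * Asymptotics of the maximum over W(n) *)

Section Asymptotics.
Set Implicit Arguments.
Unset Strict Implicit.
Local Open Scope classical_set_scope.
Local Open Scope ring_scope.
Variable R : realType.

Let s : R := ln 2.
Let t : R := ln 3.

Let s_gt0 : 0 < s. Proof. by rewrite ln_gt0 // ltr1n. Qed.
Let s_lt_t : s < t. Proof. by rewrite ltr_ln ?posrE // ltr_nat. Qed.

Let denom_gt0 : 0 < 2 * t - s. Proof. by move: s_gt0 s_lt_t; lra. Qed.

Let beta_eq : beta R * (2 * t - s) = t.
Proof. by rewrite /beta -/s -/t divfK // gt_eqF. Qed.

Let beta_itv : 0 <= beta R <= 1.
Proof.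
rewrite /beta -/s -/t divr_ge0 ?(ltW denom_gt0) //=; last by move: s_gt0 s_lt_t; lra.
by rewrite ler_pdivrMr // mul1r; move: s_lt_t; lra.
Qed.

Let gamma_eq : gamma R * s = beta R ^+ 2 / 2 * s + beta R * (1 - beta R) * t.
Proof.
by rewrite /gamma /log -/s -/t; field; rewrite gt_eqF.
Qed.

Let bin2_real b : ('C(b, 2))%:R = b%:R * (b%:R - 1) / 2 :> R.
Proof.
elim: b => [|b IHb]; first by rewrite bin0n /= !mul0r.
by rewrite binS bin1 natrD IHb -natr1; field.
Qed.

(* Completing the square around the optimal share [beta]. *)
Let ln_star_prod a b (n := (a + b)%N) : ln (star_prod a b)%:R =
  gamma R * s * n%:R ^+ 2 - (t - s / 2) * (b%:R - beta R * n%:R) ^+ 2 - b%:R * s / 2.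
Proof.
rewrite /star_prod natrM !natrX lnM ?posrE ?exprn_gt0 // !lnXn // -/s -/t.
rewrite -[_ *+ (a * b)]mulr_natl -[_ *+ 'C(b, 2)]mulr_natl natrM bin2_real gamma_eq.
rewrite /n natrD; apply/eqP; rewrite -subr_eq0; apply/eqP.
set B := beta R; set x := a%:R; set y := b%:R.
(* The difference of the two sides is a multiple of the equation defining [beta]. *)
transitivity ((B * (2 * t - s) - t) * (B * (x + y) - y) * (x + y)); first by field.
by rewrite beta_eq subrr !mul0r.
Qed.

Let ln_star_max_le n : ln (star_max n)%:R <= gamma R * s * n%:R ^+ 2.
Proof.
have [a [b [<- ->]]] := star_max_attained n.
rewrite ln_star_prod.
have ts : 0 <= t - s / 2 by move: s_gt0 s_lt_t; lra.
have bs : 0 <= b%:R * s by rewrite mulr_ge0 // ltW.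
by have := mulr_ge0 ts (sqr_ge0 (b%:R - beta R * (a + b)%:R)); lra.
Qed.

Let ln_star_max_ge n :
  gamma R * s * n%:R ^+ 2 - t - n%:R * s <= ln (star_max n)%:R.
Proof.
have /andP[b0 b1] := beta_itv.
have bn0 : 0 <= beta R * n%:R by rewrite mulr_ge0.
have bn1 : beta R * n%:R <= n%:R by rewrite ler_piMl.
(* Rounding the optimal size of R down costs at most t - s / 2 in the square term of
   [ln_star_prod]. *)
pose b := Num.truncn (beta R * n%:R).
have /andP[le_b lt_b] := truncn_itv bn0; rewrite -/b -natr1 in le_b lt_b.
have le_bn : (b <= n)%N by rewrite -(ler_nat R); exact: le_trans le_b bn1.
apply: (@le_trans _ _ (ln (star_prod (n - b) b)%:R)); last first.
  rewrite ler_ln ?posrE ?ltr0n ?star_prod_gt0 ?star_max_gt0 //.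
  by rewrite ler_nat -[in star_max _](subnK le_bn) star_prod_le_max.
rewrite ln_star_prod subnK //.
have d1 : (b%:R - beta R * n%:R) ^+ 2 <= 1 :> R by nra.
have nb : b%:R <= n%:R :> R by rewrite ler_nat.
have n0 : 0 <= n%:R :> R by [].
have bs : b%:R * s <= n%:R * s by rewrite ler_pM2r.
have ns : 0 <= n%:R * s by rewrite mulr_ge0 // ltW.
have : (t - s / 2) * (b%:R - beta R * n%:R) ^+ 2 <= t - s / 2.
  by rewrite ler_piMr //; move: s_gt0 s_lt_t; lra.
by move: s_gt0 s_lt_t; lra.
Qed.

Let ln_star_max_dist n : `|ln (star_max n)%:R - gamma R * s * n%:R ^+ 2| <= t + n%:R * s.
Proof.
have := ln_star_max_le n; have := ln_star_max_ge n.
have : 0 <= n%:R * s by rewrite mulr_ge0 // ltW.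
by move=> ? ? ?; rewrite ler_norml; apply/andP; split; move: s_gt0 s_lt_t; lra.
Qed.

Lemma star_max_powR : exists2 err : R^nat, err =O_\oo (fun n : nat => n%:R : R) &
  forall n, (star_max n)%:R = 2 `^ (gamma R * n%:R ^+ 2 + err n).
Proof.
(* The error is the exact discrepancy in base 2, so only its linear bound needs an argument. *)
exists (fun n => ln (star_max n)%:R / s - gamma R * n%:R ^+ 2).
  apply/eqOP; near=> k; near=> n.
  have n1 : 1 <= n%:R :> R by rewrite ler1n; near: n; exact: nbhs_infty_ge.
  have -> : ln (star_max n)%:R / s - gamma R * n%:R ^+ 2 =
            (ln (star_max n)%:R - gamma R * s * n%:R ^+ 2) / s.
    by field; rewrite gt_eqF.
  rewrite normrM [`|s^-1|]ger0_norm ?invr_ge0 ?(ltW s_gt0) // ler_pdivrMr //.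
  apply: (le_trans (ln_star_max_dist n)); rewrite normr_nat.
  have kt : t / s + 1 <= k by near: k; apply: nbhs_pinfty_ge; rewrite num_real.
  have le_k : (t / s + 1) * (n%:R * s) <= k * (n%:R * s).
    by rewrite ler_wpM2r // mulr_ge0 // ltW.
  rewrite -mulrA; apply: le_trans le_k.
  have -> : (t / s + 1) * (n%:R * s) = t * n%:R + n%:R * s by field; rewrite gt_eqF.
  by rewrite lerD2r ler_peMr // ltW // (lt_trans s_gt0).
move=> n; rewrite /powR ifF; last by apply/negbTE; rewrite pnatr_eq0.
rewrite addrC subrK -/s divfK ?gt_eqF // lnK // posrE ltr0n.
exact: star_max_gt0.
Unshelve. all: by end_near. Qed.

Lemma star_max_root_cvg :
  (fun n => (star_max n)%:R `^ ('C(n, 2)%:R)^-1) @ \oo --> (2 `^ (2 * gamma R) : R).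
Proof.
have -> : 2 `^ (2 * gamma R) = expR (2 * (gamma R * s)) :> R.
  by rewrite /powR ifF ?mulrA //; apply/negbTE; rewrite pnatr_eq0.
have -> : (fun n => (star_max n)%:R `^ ('C(n, 2)%:R)^-1) =
    expR \o (fun n => ('C(n, 2)%:R)^-1 * ln (star_max n)%:R) :> R^nat.
  apply/funext => n; rewrite /powR ifF //.
  by apply/negbTE; rewrite pnatr_eq0 -lt0n star_max_gt0.
apply: continuous_cvg; first exact: continuous_expR.
(* The exponents differ from their limit by at most K / (n - 1): t + s bounds the deviation from the
   quadratic term divided by n, and the last summand comes from n(n - 1) replacing n^2. *)
pose K := 2 * (t + s + `|gamma R * s|).
apply/cvgrPdist_le => e e0; near=> n.
have n2 : 2 <= n%:R :> R by rewrite ler_nat; near: n; exact: nbhs_infty_ge.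
have nK : K / e + 1 <= n%:R by near: n; exact: nbhs_infty_ger.
rewrite distrC bin2_real.
have n0 : 0 < n%:R :> R by lra.
have n10 : 0 < n%:R - 1 :> R by lra.
have -> : (n%:R * (n%:R - 1) / 2)^-1 * ln (star_max n)%:R - 2 * (gamma R * s) =
  2 * ((ln (star_max n)%:R - gamma R * s * n%:R ^+ 2) / n%:R + gamma R * s) / (n%:R - 1).
  by field; rewrite !gt_eqF.
rewrite normrM normfV [`|n%:R - 1|]gtr0_norm // ler_pdivrMr //.
apply: (@le_trans _ _ K).
  rewrite normrM ger0_norm // /K ler_pM2l //; apply: (le_trans (ler_normD _ _)).
  rewrite lerD2r normrM normfV [`|n%:R|]gtr0_norm // ler_pdivrMr //.
  apply: (le_trans (ln_star_max_dist n)); rewrite mulrDl [s * _]mulrC lerD2r.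
  by rewrite ler_peMr ?ltW // ?(lt_trans s_gt0) //; lra.
by rewrite mulrC -ler_pdivrMr // lerBrDr.
Unshelve. all: by end_near. Qed.

End Asymptotics.

(** * Passage from W(n) to F(n,4,15) and the limit of the roots *)

Local Open Scope classical_set_scope.
Local Open Scope ring_scope.

Theorem theorem2p4 (R : realType) :
  (\forall n \near \oo, forall G : multigraph 'I_n,
     maximizes (Wset n) G -> maximizes (Fset n 4 15) G) /\
  (\forall n \near \oo, ex_Pi n 4 15 = maxP (Wset n)) /\
  (exists2 err : R^nat, err =O_\oo (fun n : nat => n%:R : R) &
     \forall n \near \oo,
       (maxP (Wset n))%:R = 2 `^ (gamma R * n%:R ^+ 2 + err n)) /\
  (cvgn (ex_Pi_root R 4 15) /\ ex_Pi_lim R 4 15 = 2 `^ (2 * gamma R)).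
Proof.
have [n0 W_F] := Wset_maximizes_Fset.
have exE n : (n0 <= n)%N -> ex_Pi n 4 15 = maxP (Wset n).
  move=> le_n; have [G GW eG] := Wset_attained n.
  have Gmax : maximizes (Wset n) G by apply/Wset_maximizes.
  by rewrite (maxPE Gmax); apply/maxPE/W_F.
have root_cvg : ex_Pi_root R 4 15 @ \oo --> (2 `^ (2 * gamma R) : R).
  (* The two sequences are compared only for large n; at n = 2 and n = 3 [ex_Pi] is the default
     0. *)
  apply: cvg_trans (@star_max_root_cvg R); apply: near_eq_cvg; near=> n.
  rewrite /ex_Pi_root exE ?maxP_Wset //; near: n; exact: nbhs_infty_ge.
split; first by near=> n => G; apply: W_F; near: n; exact: nbhs_infty_ge.
split; first by near=> n; apply: exE; near: n; exact: nbhs_infty_ge.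
split; last by split; [apply/cvg_ex; eexists; exact: root_cvg|exact: cvg_lim root_cvg].
have [err errO hW] := star_max_powR R.
by exists err => //; near=> n; rewrite maxP_Wset.
Unshelve. all: by end_near. Qed.
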